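(* Let $M\ge 1$ be an integer and let $\tau>0$, $P_0>0$, $\bar{P}>0$, $R_0>0$, $R_i>0$. Let $|h_0|^2,|h_1|^2,\dots,|h_M|^2$ be independent random variables, each exponentially distributed with mean $1$, and let $|h_{(1)}|^2\le\cdots\le|h_{(M)}|^2$ be the order statistics of $|h_1|^2,\dots,|h_M|^2$. Let $N$ be the (random) number of indices $m\in\{1,\dots,M\}$ with $|h_m|^2>\tau$ (so the admitted users have gains $|h_{(M-N+1)}|^2,\dots,|h_{(M)}|^2$). For $n\ge 1$ let $R_{sum,n}=nR_i$ and $\epsilon_{s,n}=2^{R_{sum,n}}-1$, and let $\epsilon_0=2^{R_0}-1$. Define $$\mathbb{P}_0^{\mathrm{II,OL}}=1-\sum_{n=1}^{M}\mathbb{P}(N=n)\,Q_3(n)-\mathbb{P}(N=0)\,\mathbb{P}\left(\log_2(1+|h_0|^2P_0)>R_0\right),$$ where $$Q_3(n)=\mathbb{P}\left(\log_2(1+|h_0|^2P_0)>R_0,\ \log_2\left(1+\frac{\bar{P}\sum_{j=M-n+1}^{M}|h_{(j)}|^2}{1+|h_0|^2P_0}\right)>R_{sum,n}\ \middle|\ N=n\right).$$ Then, with $\tau_n=\frac{n\tau\epsilon_{s,n}^{-1}\bar{P}-1}{P_0}$ and $\bar{\tau}_n=\max\left(\tau_n,\epsilon_0P_0^{-1}\right)$, \begin{align*} \mathbb{P}_0^{\mathrm{II,OL}} =& 1-\sum_{n=1}^{M}\frac{M!}{n!(M-n)!}e^{-n\tau}\left(1-e^{-\tau}\right)^{M-n}\Bigg(\sum_{l=1}^{n-1}\frac{\epsilon_{s,n}^l\bar{P}^{-l}P_0^l}{l!}e^{-\tau_n}\frac{\Gamma\left(l+1,(\bar{\tau}_n-\tau_n)(1+\epsilon_{s,n}\bar{P}^{-1}P_0)\right)}{(1+\epsilon_{s,n}\bar{P}^{-1}P_0)^{l+1}}\\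 &+e^{-\epsilon_0P_0^{-1}}-e^{-\bar{\tau}_n}+\frac{e^{-\tau_n-(\bar{\tau}_n-\tau_n)(1+\epsilon_{s,n}\bar{P}^{-1}P_0)}}{1+\epsilon_{s,n}\bar{P}^{-1}P_0}\Bigg)-\left(1-e^{-\tau}\right)^Me^{-\epsilon_0P_0^{-1}}, \end{align*} where $\Gamma(a,x)=\int_x^\infty t^{a-1}e^{-t}\,dt$ is the upper incomplete Gamma function.
   Context: Uplink semi-grant-free NOMA model: a grant-based user $\mathrm{U}_0$ with channel $h_0$ and transmit SNR $P_0$, and $M$ grant-free users with channels $h_m$ and common transmit SNR $\bar{P}$; all channels are i.i.d. Rayleigh fading (gains i.i.d. exponential with mean 1), noise power normalized to 1. In the ''Type II open-loop'' protocol the base station broadcasts a threshold $\tau$ and exactly the grant-free users whose channel gain exceeds $\tau$ transmit, each with target rate $R_i$; the base station decodes the grant-free users first (successful decoding modeled by the sum-rate criterion with target sum rate $nR_i$, treating $\mathrm{U}_0$'s signal as interference) and $\mathrm{U}_0$'s message last, so $\mathrm{U}_0$ is successful when both events in $Q_3$ hold (or, when $N=0$, when its interference-free rate exceeds $R_0$); $\mathbb{P}_0^{\mathrm{II,OL}}$ is $\mathrm{U}_0$'s outage probability. *)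

(* Defs.v *)
From HB Require Import structures.
From mathcomp Require Import all_boot all_order all_algebra.
From mathcomp Require Import all_classical all_reals all_analysis.
From mathcomp Require Import exponential_distribution.
Set Implicit Arguments. Unset Strict Implicit. Unset Printing Implicit Defensive.
Import Order.TTheory GRing.Theory Num.Theory.
Import numFieldNormedType.Exports.
Local Open Scope classical_set_scope.
Local Open Scope ring_scope.

(* Mutual independence of a finite family of real random variables:
   for every family of Borel sets, the probability of the joint event
   factorizes (taking B i = setT covers every subfamily). *)
Definition mutually_independent d (T : measurableType d) (R : realType)
  (P : probability T R) (I : finType) (X : I -> {RV P >-> R}) : Prop :=
  forall B : I -> set R, (forall i, measurable (B i)) ->
    P (\bigcap_(i in [set: I]) (X i @^-1` B i)) =
    (\prod_(i : I) P (X i @^-1` B i))%E.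

Definition exp1_distributed d (T : measurableType d) (R : realType)
  (P : probability T R) (X : {RV P >-> R}) : Prop :=
  forall A : set R, measurable A -> distribution P X A = exponential_prob 1 A.

Definition prob d (T : measurableType d) (R : realType)
  (P : probability T R) (A : set T) : R := fine (P A).

Definition cond_prob d (T : measurableType d) (R : realType)
  (P : probability T R) (A B : set T) : R :=
  prob P (A `&` B) / prob P B.

Definition log2 (R : realType) (x : R) : R := ln x / ln 2.

Definition upper_inc_gamma (R : realType) (a x : R) : R :=
  fine (\int[@lebesgue_measure R]_(t in `[x, +oo[%classic)
          ((t `^ (a - 1)) * expR (- t))%:E)%E.

(* Gains h_0, h_1, ..., h_M are indexed by 'I_M.+1; index 0 is U_0.
   N(w) = number of grant-free users m in {1..M} with h_m(w) > tau. *)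
Definition num_admitted d (T : measurableType d) (R : realType)
  (P : probability T R) (M : nat) (h : 'I_M.+1 -> {RV P >-> R}) (tau : R)
  (w : T) : nat :=
  #|[set i : 'I_M.+1 | (0 < i)%N && (tau < h i w)]|.

(* order statistics h_(1) <= ... <= h_(M) of h_1..h_M (as a sorted list;
   h_(j) = nth 0 (order_stats ..) j.-1) *)
Definition order_stats d (T : measurableType d) (R : realType)
  (P : probability T R) (M : nat) (h : 'I_M.+1 -> {RV P >-> R}) (w : T)
  : seq R :=
  sort <=%R [seq h (lift ord0 m) w | m : 'I_M].

Definition top_sum d (T : measurableType d) (R : realType)
  (P : probability T R) (M : nat) (h : 'I_M.+1 -> {RV P >-> R}) (n : nat)
  (w : T) : R :=
  \sum_(M - n + 1 <= j < M.+1) nth 0 (order_stats h w) j.-1.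

(* Main.v *)
(** Conditioning on which set [S] of grant-free users is admitted, independence
    gives the other users a factor [P(h_j <= tau)] each, and the admitted sum
    [\sum_(i in S) h_i] is independent of [h_0].  Adding one admitted user at a
    time, Fubini turns the tail of that sum into the recursion
    [F_(n+1)(s) = \int_(y > tau) F_n(s - y) e^(-y) dy], solved by the tail of
    [n tau + Gamma(n, 1)].  Decoding succeeds iff [h_0 > eps_0 / P_0] and the
    sum exceeds [a (h_0 - tau_n) + n tau] with [a = eps_s P_0 / Pbar], so one
    more integration against the law of [h_0] yields the stated formula; all
    sets [S] of size [n] contribute equally. *)
Require Import Defs.
From HB Require Import structures.
From mathcomp Require Import all_boot all_order all_algebra.
From mathcomp Require Import all_classical all_reals all_analysis.
From mathcomp Require Import measurable_realfun exponential_distribution.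
From mathcomp Require Import ring lra.
Import Order.TTheory GRing.Theory Num.Theory.
Import numFieldNormedType.Exports.
Set Implicit Arguments. Unset Strict Implicit. Unset Printing Implicit Defensive.
Local Open Scope classical_set_scope.
Local Open Scope ring_scope.

(** Tail [P(X > x)] of the sum [X] of [n] exponential variables of mean 1; the
    strict test makes [n = 0] the tail of the constant 0. *)
Definition erlang_surv (R : realType) (n : nat) (x : R) : R :=
  if x < 0 then 1 else expR (- x) * \sum_(l < n) x ^+ l / l`!%:R.

(** * Integrals of exponentials, Erlang tails and incomplete Gamma functions *)

Section exponential_integrals.
Context (R : realType).
Notation mu := (@lebesgue_measure R).
Implicit Types a b e t u x y : R.

Lemma measurable_erlang_surv n : measurable_fun setT (@erlang_surv R n).
Proof.
apply: measurable_fun_ifT => //.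
  exact: measurable_fun_ltr.
apply: measurable_funM; first exact: measurableT_comp.
  apply: measurable_sum => l; apply: measurable_funM => //.
Qed.

Lemma erlang_surv_ge0 n x : 0 <= erlang_surv n x.
Proof.
rewrite /erlang_surv; case: ltP => // x0.
by rewrite mulr_ge0 ?expR_ge0// sumr_ge0// => l _; rewrite divr_ge0// exprn_ge0.
Qed.

Lemma measurable_expRN (D : set R) :
  measurable_fun D (fun y : R => (expR (- y))%:E).
Proof.
by apply: measurable_funTS; apply/measurable_EFinP; exact: measurableT_comp.
Qed.

Lemma ge0_integral_itv_split (i j k : itv_bound R) (f : R -> \bar R) :
  (i <= j)%O -> (j <= k)%O -> measurable_fun setT f ->
  (forall x, x \in Interval i k -> (0 <= f x)%E) ->
  (\int[mu]_(x in [set` Interval i k]) f x =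
   \int[mu]_(x in [set` Interval i j]) f x +
   \int[mu]_(x in [set` Interval j k]) f x)%E.
Proof.
move=> ij jk mf f0; rewrite (itv_bndbnd_setU ij jk) ge0_integral_setU//.
- exact: measurable_funTS.
- by move=> x; rewrite -(itv_bndbnd_setU ij jk); exact: f0.
- apply/disj_setPS => x [] /=; rewrite !inE/= => /andP[_ xj] /andP[jx _].
  by have := le_trans xj jx; rewrite bnd_simp ltxx.
Qed.

Lemma integral_expRN_cy a :
  (\int[mu]_(y in `[a, +oo[) (expR (- y))%:E = (expR (- a))%:E)%E.
Proof.
have cexpN : continuous (fun y : R^o => expR (- y)).
  move=> y; apply: continuous_comp; last exact: continuous_expR.
  exact: continuousN.
rewrite (@ge0_continuous_FTC2y _ _ (fun x => - (expR (- x))) _ 0).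
- by rewrite sub0e EFinN oppeK.
- by move=> x _; exact: expR_ge0.
- exact/continuous_subspaceT.
- by rewrite -oppr0; apply: cvgN; exact: cvgr_expR.
- by move=> x _; exact: ex_derive.
- by apply: cvgN; apply/cvg_at_right_filter; exact: cexpN.
- move=> x _; rewrite derive1E derive_val; lra.
Qed.

Lemma integral_expRN_oy a :
  (\int[mu]_(y in `]a, +oo[) (expR (- y))%:E = (expR (- a))%:E)%E.
Proof.
by rewrite integral_itv_obnd_cbnd ?integral_expRN_cy//; exact: measurable_expRN.
Qed.

Lemma integral_expRN_co a b : a <= b ->
  (\int[mu]_(y in `[a, b[) (expR (- y))%:E = (expR (- a) - expR (- b))%:E)%E.
Proof.
move=> ab; have := integral_expRN_cy a.
rewrite (@ge0_integral_itv_split _ (BLeft b)) ?bnd_simp//; last first.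
  exact: measurable_expRN.
by rewrite integral_expRN_cy EFinB => <-; rewrite addeK.
Qed.

Lemma integral_power_cc a b l : a < b ->
  (\int[mu]_(y in `[a, b]) ((b - y) ^+ l / l`!%:R)%:E =
   ((b - a) ^+ l.+1 / l.+1`!%:R)%:E)%E.
Proof.
move=> ab.
have dF k (y : R) : is_derive y 1 (fun y => - ((b - y) ^+ k.+1 / k.+1`!%:R))
    ((b - y) ^+ k / k`!%:R).
  rewrite (_ : (fun _ => _) = - ((k.+1`!%:R)^-1 \*: (cst b - id) ^+ k.+1)); last first.
    by apply/funext => z; rewrite /= !fctE mulrC.
  apply: is_derive_eq; rewrite /= !fctE factS natrM scalerA /GRing.scale/=.
  have : k.+1%:R != 0 :> R by rewrite pnatr_eq0.
  have : k`!%:R != 0 :> R by rewrite pnatr_eq0 -lt0n fact_gt0.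
  by move=> *; field; apply/andP.
have cF k : continuous (fun y : R^o => - ((b - y) ^+ k.+1 / k.+1`!%:R)).
  by move=> y; apply/differentiable_continuous/derivable1_diffP; case: (dF k y).
rewrite (@continuous_FTC2 _ _ (fun y => - ((b - y) ^+ l.+1 / l.+1`!%:R)))//.
- by rewrite subrr expr0n mul0r oppr0 sub0e -EFinN opprK.
- apply: continuous_subspaceT => y.
  apply: (@continuousM _ R^o (fun y => (b - y) ^+ l) (cst l`!%:R^-1));
    last exact: cst_continuous.
  apply: (@continuous_comp _ _ _ (fun y : R^o => b - y) (fun z => z ^+ l)).
    by apply: continuousB => //; exact: cst_continuous.
  exact: exprn_continuous.
- split => [x _| |].
  + by case: (dF l x).
  + by apply/cvg_at_right_filter; exact: cF.
  + by apply/cvg_at_left_filter; exact: cF.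
- by move=> x _; rewrite derive1E derive_val.
Qed.

(** At the boundary [x = 0] only the term [l = 0] survives and gives 1. That term exists only with
    at least one summand, hence the index [n.+1]. *)
Lemma erlang_surv_le0 n x : x <= 0 -> erlang_surv n.+1 x = 1.
Proof.
rewrite /erlang_surv le_eqVlt => /predU1P[->|->//].
rewrite ltxx oppr0 expR0 mul1r big_ord_recl expr0 divr1 big1 ?addr0//.
by move=> i _; rewrite exprS !mul0r.
Qed.

(** This is the convolution step that adds one exponential variable conditioned to exceed [t]. For
    [y <= u] the exponentials combine to the constant [expR (- u)], so only powers of [u - y] are
    integrated and each degree rises by one. The piece [y > u], where the tail equals 1, supplies
    the missing term of degree 0. *)
Lemma erlang_surv_recursion n u t :
  (\int[mu]_(y in `]t, +oo[) (erlang_surv n (u - y) * expR (- y))%:E =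
   (expR (- t) * erlang_surv n.+1 (u - t))%:E)%E.
Proof.
have mf : measurable_fun setT (fun y : R => (erlang_surv n (u - y) * expR (- y))%:E).
  apply/measurable_EFinP; apply: measurable_funM;
    last exact: measurableT_comp.
  by apply: measurableT_comp (measurable_erlang_surv n) _; exact: measurable_funB.
have mpow l (D : set R) : measurable_fun D (fun y => ((u - y) ^+ l / l`!%:R)%:E).
  apply: measurable_funTS; apply/measurable_EFinP; apply: measurable_funM => //.
  by apply: measurable_funX; exact: measurable_funB.
(* If [u <= t], the argument [u - y] is negative on the whole range, so the tail is constantly 1 and
   only the exponential is integrated. *)
have [ut|tu] := leP u t.
  rewrite erlang_surv_le0 ?subr_le0// mulr1 -integral_expRN_oy.
  apply: eq_integral => y; rewrite inE/= in_itv/= andbT => ty.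
  by rewrite /erlang_surv subr_lt0 (le_lt_trans ut ty) mul1r.
rewrite (@ge0_integral_itv_split _ (BRight u)) ?bnd_simp//; last 2 first.
  exact: ltW.
  by move=> x _; rewrite lee_fin mulr_ge0 ?expR_ge0 ?erlang_surv_ge0.
rewrite [X in (_ + X)%E](_ : _ = (expR (- u))%:E); last first.
  rewrite -integral_expRN_oy; apply: eq_integral => y.
  by rewrite inE/= in_itv/= andbT => uy; rewrite /erlang_surv subr_lt0 uy mul1r.
rewrite integral_itv_obnd_cbnd; last exact: measurable_funTS.
under eq_integral => y.
  rewrite inE/= in_itv/= => /andP[ty yu].
  rewrite /erlang_surv subr_lt0 ltNge yu/= mulrAC -expRD opprB addrAC subrr add0r.
  rewrite EFinM -sumEFin.
  over.
rewrite ge0_integralZl//=; last 2 first.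
- by apply: emeasurable_sum => l; exact: mpow.
- move=> y; rewrite in_itv/= => /andP[_ yu]; rewrite sume_ge0// => l _.
  by rewrite lee_fin divr_ge0// exprn_ge0// subr_ge0.
rewrite ge0_integral_sum//=; last 2 first.
- by move=> l; exact: mpow.
- move=> l y; rewrite in_itv/= => /andP[_ yu].
  by rewrite lee_fin divr_ge0// exprn_ge0// subr_ge0.
under eq_bigr do rewrite integral_power_cc//.
rewrite sumEFin -EFinM -EFinD; congr EFin.
rewrite /erlang_surv subr_lt0 ltNge (ltW tu)/= mulrA -expRD.
rewrite big_ord_recl expr0 divr1 mulrDr mulr1 addrC; congr (_ + _).
  by congr expR; ring.
by congr (expR _ * _); ring.
Qed.

(** The change of variable [x = c * (y - s)]. Nonnegativity of [G] is asked only beyond the lower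
    endpoint because [G] will be [z ^+ l * expR (- z)], which is negative at negative [z] for odd
    [l]. *)
Lemma ge0_integral_affine_substitution (c s a : R) (G : R -> R) :
  0 < c -> continuous (G : R^o -> R^o) -> (forall x, c * (a - s) < x -> 0 <= G x) ->
  (\int[mu]_(x in `[(c * (a - s))%R, +oo[) (G x)%:E =
   \int[mu]_(y in `[a, +oo[) (G (c * (y - s)) * c)%:E)%E.
Proof.
move=> c0 cG G0.
pose F := fun y : R => c * (y - s).
have dF (y : R) : is_derive y 1 F c.
  rewrite (_ : F = c \*: (id - cst s)); last by apply/funext => z.
  by apply: is_derive_eq; rewrite subr0 /GRing.scale/= mulr1.
have cF : continuous (F : R^o -> R^o).
  by move=> y; apply/differentiable_continuous/derivable1_diffP; case: (dF y).
have F' : F^`()%classic = cst c.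
  by apply/funext => y; rewrite derive1E derive_val.
rewrite -[c * (a - s)]/(F a) increasing_ge0_integration_by_substitutiony//.
- by rewrite F'.
- by move=> x y _ _ xy; rewrite ltr_pM2l// ltrD2r.
- by move=> x _; rewrite F'; exact: cst_continuous.
- by rewrite F'; apply: is_cvg_cst.
- by rewrite F'; apply: is_cvg_cst.
- split => [x _|]; first by case: (dF x).
  by apply/cvg_at_right_filter; exact: cF.
- by apply: gt0_cvgMry => //; exact: cvg_addrr.
- exact: continuous_subspaceT.
- by move=> x; rewrite in_itv/= andbT; exact: G0.
Qed.

Lemma power_le_expR l x : 0 <= x -> x ^+ l / l`!%:R <= expR x.
Proof.
case: l => [|l] x0; first by rewrite expr0 divr1 -expR0 ler_expR.
by apply: le_trans (expR_ge1Dxn l x0); rewrite lerDr.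
Qed.

(** Since [upper_inc_gamma] is defined through [fine], it equals the integral only once the latter
    is known to be finite. Finiteness comes from domination by a multiple of [expR (- (t / 2))]. *)
Lemma upper_inc_gamma_natE l x : 0 <= x ->
  (\int[mu]_(t in `[x, +oo[) (t ^+ l * expR (- t))%:E =
   (upper_inc_gamma l.+1%:R x)%:E)%E.
Proof.
move=> x0.
have mf D : measurable_fun D (fun t : R => (t ^+ l * expR (- t))%:E).
  apply: measurable_funTS; apply/measurable_EFinP; apply: measurable_funM => //.
  exact: measurableT_comp.
transitivity (fine (\int[mu]_(t in `[x, +oo[) (t ^+ l * expR (- t))%:E))%:E; last first.
  congr (fine _)%:E; apply: eq_integral => t.
   rewrite inE/= in_itv/= andbT => xt; rewrite -natr1 addrK.
  by rewrite powR_mulrn// (le_trans x0).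
have mexp D : measurable_fun D (fun t : R => (expR (- (2^-1 * (t - 0))) * 2^-1)%:E).
  apply: measurable_funTS; apply/measurable_EFinP; apply: measurable_funM => //.
  apply: measurableT_comp => //; apply: measurableT_comp => //.
  by apply: measurable_funM => //; exact: measurable_funB.
rewrite fineK// ge0_fin_numE; last first.
  apply: integral_ge0 => t; rewrite /= in_itv/= andbT => xt.
  by rewrite lee_fin mulr_ge0 ?expR_ge0// exprn_ge0// (le_trans x0).
(* The majorant comes from [power_le_expR] at [t / 2]. Its spare factor [2^-1] is the Jacobian of
   the substitution [t / 2], which makes [ge0_integral_affine_substitution] applicable, and one
   extra power of 2 in the constant compensates for it. *)
apply: (@le_lt_trans _ _ (\int[mu]_(t in `[x, +oo[)
    ((2 ^+ l.+1 * l`!%:R)%:E * (expR (- (2^-1 * (t - 0))) * 2^-1)%:E))%E).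
  apply: ge0_le_integral => //=.
  - move=> t; rewrite in_itv/= andbT => xt.
    by rewrite lee_fin mulr_ge0 ?expR_ge0// exprn_ge0// (le_trans x0).
  - exact: mf.
  - by apply: measurable_funeM; exact: mexp.
  - move=> t; rewrite in_itv/= andbT => xt; rewrite -EFinM lee_fin subr0.
    have t0 : 0 <= t / 2 by rewrite divr_ge0// (le_trans x0).
    have := power_le_expR l t0.
    rewrite expr_div_n ler_pdivrMr ?ltr0n ?fact_gt0// ler_pdivrMr ?exprn_gt0//.
    move=> /(ler_wpM2r (expR_ge0 (- t))) /le_trans; apply.
    have -> : expR (- t) = (expR (t / 2))^-1 * expR (- (2^-1 * t)).
      by rewrite -expRN -expRD; congr expR; field.
    rewrite exprS le_eqVlt; apply/orP; left; apply/eqP.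
    by field; rewrite gt_eqF ?expR_gt0.
rewrite ge0_integralZl//=; last first.
  exact: mexp.
rewrite -(@ge0_integral_affine_substitution _ _ _ (fun y => expR (- y)))//.
- by rewrite integral_expRN_cy -EFinM ltry.
- move=> y; apply: continuous_comp; last exact: continuous_expR.
  exact: continuousN.
Qed.

Lemma upper_inc_gamma1 x : 0 <= x -> upper_inc_gamma 1 x = expR (- x).
Proof.
move=> x0; have := upper_inc_gamma_natE 0 x0.
under eq_integral do rewrite expr0 mul1r.
by rewrite integral_expRN_cy => -[].
Qed.

(** The range is cut at [t]: below it the tail is 1, above it the polynomial form holds. There
    [a * (y - s) + y = s + c * (y - s)], so every term becomes an incomplete Gamma integral in
    [c * (y - s)]. *)
Lemma integral_erlang_surv_affine n (r a s : R) : 0 < a ->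
  let t := Num.max s r in let c := 1 + a in
  (\int[mu]_(y in `]r, +oo[) (erlang_surv n.+1 (a * (y - s)) * expR (- y))%:E =
   (expR (- r) - expR (- t) +
    \sum_(l < n.+1) a ^+ l / l`!%:R * expR (- s) *
      upper_inc_gamma l.+1%:R ((t - s) * c) / c ^+ l.+1)%:E)%E.
Proof.
move=> a0 t c.
have c0 : 0 < c by rewrite addr_gt0.
have st : s <= t by rewrite le_max lexx.
have rt : r <= t by rewrite le_max lexx orbT.
have mf : measurable_fun setT
    (fun y : R => (erlang_surv n.+1 (a * (y - s)) * expR (- y))%:E).
  apply/measurable_EFinP; apply: measurable_funM;
    last exact: measurableT_comp.
  apply: measurableT_comp (measurable_erlang_surv n.+1) _.
  by apply: measurable_funM => //; exact: measurable_funB.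
rewrite integral_itv_obnd_cbnd; last exact: measurable_funTS.
rewrite (@ge0_integral_itv_split _ (BLeft t)) ?bnd_simp//; last first.
  by move=> y _; rewrite lee_fin mulr_ge0 ?expR_ge0 ?erlang_surv_ge0.
(* Either [t = s] and the argument of the tail is nonpositive on the interval, or [t = r] and the
   interval is empty. *)
rewrite [X in (X + _)%E](_ : _ = (expR (- r) - expR (- t))%:E); last first.
  rewrite -integral_expRN_co//; apply: eq_integral => y.
  rewrite inE/= in_itv/= => /andP[ry].
  rewrite lt_max => /orP[ys|/(le_lt_trans ry)]; last by rewrite ltxx.
  by rewrite erlang_surv_le0 ?mul1r// pmulr_rle0// subr_le0 ltW.
rewrite [RHS]EFinD; congr (_ + _)%E.
have mpow l (D : set R) : measurable_fun D
    (fun y => (((c * (y - s)) ^+ l * expR (- (c * (y - s)))) * c)%:E).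
  apply: measurable_funTS; apply/measurable_EFinP; apply: measurable_funM => //.
  have mc : measurable_fun setT (fun y : R => c * (y - s)).
    by apply: measurable_funM => //; exact: measurable_funB.
  apply: measurable_funM; first exact: measurable_funX.
  by apply: measurableT_comp => //; exact: measurableT_comp.
(* A factor [c] is set aside in each term as the Jacobian; this is why the constant carries
   [c ^+ l.+1] rather than [c ^+ l]. *)
transitivity (\int[mu]_(y in `[t, +oo[) (\sum_(l < n.+1)
    ((a ^+ l / l`!%:R * expR (- s) / c ^+ l.+1)%:E *
    (((c * (y - s)) ^+ l * expR (- (c * (y - s)))) * c)%:E)))%E.
  apply: eq_integral => y; rewrite inE/= in_itv/= andbT => ty.
  rewrite /erlang_surv ltNge mulr_ge0 ?subr_ge0 ?(le_trans st ty) ?(ltW a0)//=.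
  rewrite mulr_sumr mulr_suml -sumEFin; apply: eq_bigr => l _; rewrite -EFinM; congr EFin.
  have -> : expR (- (a * (y - s))) = expR (- s) * expR (- (c * (y - s))) * (expR (- y))^-1.
    by rewrite -expRN -!expRD; congr expR; rewrite /c; ring.
  rewrite !exprMn exprS; field.
  by rewrite !gt_eqF ?expR_gt0 ?exprn_gt0 ?ltr0n ?fact_gt0.
rewrite ge0_integral_sum//=; last 2 first.
- by move=> l; apply: measurable_funeM; exact: mpow.
- move=> l y; rewrite in_itv/= andbT => ty; rewrite -EFinM lee_fin.
  have ys : 0 <= y - s by rewrite subr_ge0 (le_trans st).
  by rewrite !mulr_ge0 ?exprn_ge0 ?expR_ge0 ?invr_ge0 ?exprn_ge0 ?mulr_ge0// ltW.
rewrite -sumEFin; apply: eq_bigr => l _.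
rewrite ge0_integralZl//=; last 3 first.
- exact: mpow.
- move=> y; rewrite in_itv/= andbT => ty; rewrite lee_fin.
  have ys : 0 <= y - s by rewrite subr_ge0 (le_trans st).
  by rewrite !mulr_ge0 ?exprn_ge0 ?expR_ge0 ?mulr_ge0// ltW.
- by rewrite lee_fin !mulr_ge0 ?exprn_ge0 ?expR_ge0 ?invr_ge0 ?exprn_ge0// ltW.
rewrite -(@ge0_integral_affine_substitution c s t (fun z => z ^+ l * expR (- z)))//.
- rewrite upper_inc_gamma_natE; last by rewrite mulr_ge0 ?subr_ge0// ltW.
  by rewrite -EFinM (mulrC c) mulrAC.
- move=> z; apply: (@continuousM _ R^o (fun z => z ^+ l) (fun z => expR (- z))).
    exact: exprn_continuous.
  by apply: continuous_comp; [exact: continuousN|exact: continuous_expR].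
- move=> x xlt; rewrite mulr_ge0 ?expR_ge0// exprn_ge0//.
  by rewrite (le_trans _ (ltW xlt))// mulr_ge0 ?subr_ge0// ltW.
Qed.

End exponential_integrals.

(** * Joint law of a variable restricted to an event and an independent variable with a density *)

Section joint_density.
Context (R : realType) d (T : measurableType d) (P : probability T R).
Variables (D : set T) (mD : measurable D) (X : {mfun T >-> R}).

(** The unnormalised law of [X] on [D], a finite measure of total mass [P D]. Leaving out the
    normalisation avoids dividing by [P D]. *)
Definition restr_law : set R -> \bar R := pushforward (mrestr P mD) X.

Let restr_law0 : restr_law set0 = 0%E. Proof. exact: measure0. Qed.
Let restr_law_ge0 A : (0 <= restr_law A)%E. Proof. exact: measure_ge0. Qed.
Let restr_law_sigma_additive : semi_sigma_additive restr_law.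
Proof. exact: measure_semi_sigma_additive. Qed.

HB.instance Definition _ := isMeasure.Build _ _ _ restr_law
  restr_law0 restr_law_ge0 restr_law_sigma_additive.

Let restr_law_fin : fin_num_fun restr_law.
Proof.
move=> A mA; apply: (@fin_num_measure _ _ _ (mrestr P mD)).
by rewrite -[X in measurable X]setTI; exact: measurable_funP.
Qed.

HB.instance Definition _ := Measure_isFinite.Build _ _ _ restr_law restr_law_fin.

Lemma restr_lawE A : restr_law A = P (D `&` X @^-1` A).
Proof. by rewrite /restr_law /pushforward /mrestr setIC. Qed.

(* The density of [Y] enters after Tonelli on [restr_law \x lebesgue_measure],
   so no integral against the law of [Y] has to be evaluated. *)
Lemma joint_density (Y : {mfun T >-> R}) (p : R -> R) (E : set (R * R)) :
  measurable_fun setT p -> (forall y, 0 <= p y) ->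
  (forall B, measurable B ->
    P (Y @^-1` B) = \int[lebesgue_measure]_(y in B) (p y)%:E)%E ->
  (forall A B, measurable A -> measurable B ->
    P (D `&` X @^-1` A `&` Y @^-1` B) = P (D `&` X @^-1` A) * P (Y @^-1` B))%E ->
  measurable E ->
  P (D `&` (fun w => (X w, Y w)) @^-1` E) =
  (\int[lebesgue_measure]_y (P (D `&` X @^-1` ysection E y) * (p y)%:E))%E.
Proof.
move=> mp p0 Yp XY mE.
have mXY : measurable_fun setT (fun w => (X w, Y w)).
  exact: measurable_fun_pair.
pose joint : {measure set (R * R) -> \bar R} :=
  pushforward (mrestr P mD) (fun w => (X w, Y w)).
pose m' := joint mXY.
have -> : P (D `&` (fun w => (X w, Y w)) @^-1` E) = m' E.
  by rewrite /m' /joint/= /pushforward /mrestr setIC.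
(* The factorization hypothesis says that the joint law on [D] and the product measure agree on
   rectangles; uniqueness of the product measure extends this to [E]. *)
rewrite -(@product_measure_unique _ _ _ _ _ restr_law (distribution P Y) m')//; last first.
  move=> A B mA mB /=; rewrite restr_lawE -XY// /m' /joint/= /pushforward /mrestr.
  by congr (P _); apply/seteqP; split => w /=; tauto.
rewrite /product_measure1.
pose f (z : R * R) : \bar R := (\1_E z * p z.2)%:E.
transitivity (\int[restr_law]_x \int[lebesgue_measure]_y f (x, y))%E.
  apply: eq_integral => x _; rewrite /= /distribution /pushforward Yp; last first.
    exact: measurable_xsection.
  rewrite integral_mkcond; apply: eq_integral => y _.
  rewrite patchE mem_xsection /f /= indicE.
  by case: ifP => _; rewrite ?mul1r ?mul0r.
rewrite (@fubini_tonelli _ _ R (measurableTypeR R) R restr_law lebesgue_measure f)//;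
  last 2 first.
- apply/measurable_EFinP; apply: measurable_funM; first exact: measurable_indic.
  exact: measurableT_comp.
- by move=> z; rewrite lee_fin mulr_ge0.
apply: eq_integral => y _; rewrite /fubini_G -restr_lawE.
rewrite -[in RHS](setIT (ysection E y)) -integral_indic//; last exact: measurable_ysection.
rewrite muleC -ge0_integralZl//.
- by apply: eq_integral => x _; rewrite /f /= EFinM muleC !indicE mem_ysection.
- by apply/measurable_EFinP/measurable_indic; exact: measurable_ysection.
- by rewrite lee_fin.
Qed.

End joint_density.

Section erlang_sum.
Context (R : realType) d (T : measurableType d) (P : probability T R).
Variables (I : finType) (h : I -> {RV P >-> R}) (tau : R).
Hypothesis (tau_ge0 : 0 <= tau) (h_indep : mutually_independent h).
Hypothesis h_exp : forall i, exp1_distributed (h i).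
Implicit Types (S : {set I}) (A : set R) (B : I -> set R).

(** Keeping arbitrary events [B i] for users outside [S] lets an induction on [S] admit one more
    user by overriding a single event. *)
Definition exceed S B : set T :=
  \bigcap_i h i @^-1` (if i \in S then `]tau, +oo[%classic else B i).

Definition gain_sum S : {mfun T >-> R} := \sum_(i in S) h i.

Definition override B i A := fun j => if j == i then A else B j.

Let pdf := exponential_pdf (1 : R).

Lemma measurable_RV_preimage (X : {mfun T >-> R}) A :
  measurable A -> measurable (X @^-1` A).
Proof. by move=> mA; rewrite -[X in measurable X]setTI; exact: measurable_funP. Qed.

Lemma measurable_exceed S B : (forall i, measurable (B i)) -> measurable (exceed S B).
Proof.
move=> mB; apply: fin_bigcap_measurable; first exact: finite_finset.
by move=> i _; apply: measurable_RV_preimage; case: ifP.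
Qed.

Lemma measurable_override B i A : (forall i, measurable (B i)) -> measurable A ->
  forall j, measurable (override B i A j).
Proof. by move=> mB mA j; rewrite /override; case: ifP. Qed.

Lemma exp1_preimage i A : measurable A ->
  P (h i @^-1` A) = (\int[lebesgue_measure]_(y in A) (pdf y)%:E)%E.
Proof. by move=> mA; rewrite -[RHS](h_exp i mA). Qed.

Lemma exceedD S B i A : i \notin S ->
  exceed S (override B i A) = exceed S (override B i setT) `&` h i @^-1` A.
Proof.
move=> iS; apply/seteqP; split => w /=.
  move=> hw; split; last first.
    by have := hw i Logic.I; rewrite /= (negbTE iS) /override eqxx.
  move=> j _ /=; have := hw j Logic.I; rewrite /= /override.
  by case: ifP => // _; case: ifP.
move=> [hw hi] j _ /=; have := hw j Logic.I; rewrite /= /override.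
by case: ifP => // _; case: eqP => // ->.
Qed.

Lemma exceedU1 S B i : i \notin S ->
  exceed (i |: S) B = exceed S (override B i `]tau, +oo[%classic).
Proof.
move=> iS; apply: eq_bigcapr => j _; rewrite in_setU1 /override.
by case: eqP => //= ->; rewrite (negbTE iS).
Qed.

Lemma gain_sumU1 S i w : i \notin S -> gain_sum (i |: S) w = gain_sum S w + h i w.
Proof. by move=> iS; rewrite /gain_sum !mfun_sum big_setU1//= addrC. Qed.

(** Independence of the users outside [S] from the admission of [S] together with its sum. It is a
    predicate on [S] because it is derived from mutual independence one user at a time. *)
Definition exceed_factor S := forall B A, (forall i, measurable (B i)) ->
  measurable A ->
  P (exceed S B `&` gain_sum S @^-1` A) =
  (P (exceed S (fun=> setT) `&` gain_sum S @^-1` A) *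
   \prod_(i | i \notin S) P (h i @^-1` B i))%E.

Lemma exceed_factor0 : exceed_factor finset.set0.
Proof.
move=> B A mB mA.
have e0 B' : exceed finset.set0 B' = \bigcap_i h i @^-1` B' i.
  by apply: eq_bigcapr => i _; rewrite finset.in_set0.
(* The empty sum is 0, so its event is everything or nothing according to whether [A] contains 0. *)
have [A0|A0] := pselect (A 0).
  rewrite [gain_sum _ @^-1` _](_ : _ = setT) ?setIT; last first.
    by apply/seteqP; split => // w _; rewrite /= /gain_sum mfun_sum big_set0.
  rewrite !e0 !h_indep// [X in (X * _)%E]big1 ?mul1e; last first.
    by move=> i _; rewrite preimage_setT probability_setT.
  by apply: eq_bigl => i; rewrite finset.in_set0.
rewrite [gain_sum _ @^-1` _](_ : _ = set0) ?setI0 ?measure0 ?mul0e//.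
by apply/seteqP; split => // w; rewrite /= /gain_sum mfun_sum big_set0.
Qed.

(** [joint_density] is applied on the event that leaves user [i] free. [exceed_factor] first
    provides the independence of [h i] that this requires, then takes the factors of the remaining
    users out of the integral. *)
Lemma exceed_pair S i B (E : set (R * R)) : exceed_factor S -> i \notin S ->
  (forall i, measurable (B i)) -> measurable E ->
  P (exceed S (override B i setT) `&` (fun w => (gain_sum S w, h i w)) @^-1` E) =
  ((\prod_(j | (j \notin S) && (j != i)) P (h j @^-1` B j)) *
   \int[lebesgue_measure]_y
     (P (exceed S (fun=> setT) `&` gain_sum S @^-1` ysection E y) * (pdf y)%:E))%E.
Proof.
move=> fS iS mB mE.
have mBT := measurable_override i mB measurableT.
have prodE A : measurable A -> (\prod_(j | j \notin S) P (h j @^-1` override B i A j) =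
    P (h i @^-1` A) * \prod_(j | (j \notin S) && (j != i)) P (h j @^-1` B j))%E.
  move=> mA; rewrite (bigD1 i)//= /override eqxx; congr (_ * _)%E.
  by apply: eq_bigr => j /andP[_ /negbTE ->].
rewrite (@joint_density _ _ _ _ _ (measurable_exceed S mBT) _ _ pdf)//; last 4 first.
- exact: measurable_exponential_pdf.
- by move=> y; exact: exponential_pdf_ge0.
- by move=> A mA; exact: exp1_preimage.
- move=> A C mA mC; rewrite setIAC -exceedD// fS//; last exact: measurable_override.
  rewrite [in RHS]fS// !prodE// preimage_setT probability_setT mul1e.
  by rewrite muleA muleAC.
rewrite -ge0_integralZl//=.
- apply: eq_integral => y _; rewrite fS//; last exact: measurable_ysection.
  by rewrite prodE// preimage_setT probability_setT mul1e [in RHS]muleA (muleC (P _)).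
- apply: emeasurable_funM; last first.
    by apply/measurable_EFinP; exact: measurable_exponential_pdf.
  have mT : measurable (exceed S (fun=> setT)) by exact: measurable_exceed.
  have := @measurable_fun_ysection _ _ _ _ _ (restr_law P mT (gain_sum S)) E mE.
  by congr (measurable_fun _ _); apply/funext => y /=; rewrite restr_lawE.
- by move=> y _; rewrite mule_ge0// lee_fin exponential_pdf_ge0.
- by apply: prode_ge0.
Qed.

Let sum_section A : set (R * R) := [set z | tau < z.2 /\ A (z.1 + z.2)].

Let measurable_sum_section A : measurable A -> measurable (sum_section A).
Proof.
move=> mA.
rewrite [sum_section A](_ : _ = snd @^-1` `]tau, +oo[%classic `&`
    (fun z : R * R => z.1 + z.2) @^-1` A); last first.
  by apply/seteqP; split => z /=; rewrite in_itv/= andbT.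
apply: measurableI.
- by rewrite -[X in measurable X]setTI; exact: measurable_snd.
- by rewrite -[X in measurable X]setTI; exact: measurable_funD.
Qed.

Let exceedU1_sum S i B A : i \notin S ->
  exceed (i |: S) B `&` gain_sum (i |: S) @^-1` A =
  exceed S (override B i setT) `&`
    (fun w => (gain_sum S w, h i w)) @^-1` sum_section A.
Proof.
move=> iS; rewrite exceedU1// exceedD// -setIA; congr (_ `&` _).
by apply/seteqP; split => w /=; rewrite gain_sumU1// in_itv/= andbT.
Qed.

(** By [exceed_pair], both sides contain the same integral over the gain of user [i]; they differ
    only by the product over the remaining users, which is 1 when all their events are [setT]. *)
Lemma exceed_factorU1 S i : i \notin S -> exceed_factor S -> exceed_factor (i |: S).
Proof.
move=> iS fS B A mB mA.
have mE := measurable_sum_section mA.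
rewrite !exceedU1_sum// !exceed_pair// [X in (X * _ * _)%E]big1; last first.
  by move=> j _; rewrite preimage_setT probability_setT.
rewrite mul1e muleC; congr (_ * _)%E; apply: eq_bigl => j.
by rewrite in_setU1 negb_or andbC.
Qed.

Lemma exceed_factorT S : exceed_factor S.
Proof.
have [n] := ubnP #|S|; elim: n S => // n IH S.
have [->|[i iS]] := finset.set_0Vmem S; first by move=> _; exact: exceed_factor0.
rewrite (cardsD1 i) iS /= ltnS => Sn; rewrite -(finset.setD1K iS).
by apply: exceed_factorU1; [rewrite finset.setD11|exact: IH].
Qed.

Lemma exceed_surv S s :
  P (exceed S (fun=> setT) `&` gain_sum S @^-1` `]s, +oo[%classic) =
  (expR (- (#|S|%:R * tau)) * erlang_surv #|S| (s - #|S|%:R * tau))%:E.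
Proof.
have [n] := ubnP #|S|; elim: n S s => // n IH S s.
have [->|[i iS]] := finset.set_0Vmem S.
  move=> _; rewrite cards0 mul0r oppr0 expR0 mul1r addr0 /erlang_surv.
  rewrite [exceed _ _](_ : _ = setT) ?setTI; last first.
    by apply/seteqP; split => // w _ i _; rewrite finset.in_set0.
  rewrite [_ @^-1` _](_ : _ = if s < 0 then setT else set0).
    by case: ifP => _; rewrite ?probability_setT ?measure0// big_ord0 mulr0.
  apply/seteqP; split => w; rewrite /= /gain_sum mfun_sum big_set0 in_itv/= andbT.
    by move=> ->.
  by case: ifP.
rewrite (cardsD1 i) iS /= ltnS => Sn; rewrite -{1 2}(finset.setD1K iS).
set S' := S :\ i in Sn *; have iS' : i \notin S' by rewrite finset.setD11.
rewrite exceedU1_sum// exceed_pair//; last 2 first.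
- exact: exceed_factorT.
- exact: measurable_sum_section.
rewrite big1 ?mul1e; last by move=> j _; rewrite preimage_setT probability_setT.
set k := #|S'|.
transitivity (\int[lebesgue_measure]_(y in `]tau, +oo[)
    ((expR (- (k%:R * tau)))%:E *
     (erlang_surv k (s - k%:R * tau - y) * expR (- y))%:E))%E.
  rewrite [in RHS]integral_mkcond; apply: eq_integral => y _; rewrite patchE.
  rewrite mem_setE in_itv/= andbT; case: ifPn => ytau.
    rewrite [_ @^-1` _](_ : _ = gain_sum S' @^-1` `](s - y), +oo[%classic); last first.
      apply/seteqP; split => w /=; rewrite in_itv/= andbT ltrBlDr.
        by move=> /ysectionP[_] /=; rewrite in_itv/= andbT.
      by move=> sw; apply/ysectionP; split => //=; rewrite in_itv/= andbT.
    rewrite IH// /pdf exponential_pdfE ?(le_trans tau_ge0 (ltW ytau))// mul1r mulN1r.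
    by rewrite -!EFinM mulrA (addrAC s).
  rewrite [_ @^-1` _](_ : _ = set0) ?setI0 ?measure0 ?mul0e//.
  apply/seteqP; split => // w /= /ysectionP[/=].
  by rewrite (negbTE ytau).
rewrite ge0_integralZl_EFin//=.
- rewrite erlang_surv_recursion -EFinM mulrA -expRD; congr (expR _ * erlang_surv _ _)%:E.
    by rewrite -nat1r; ring.
  by rewrite -nat1r; ring.
- by move=> y _; rewrite lee_fin mulr_ge0 ?expR_ge0// erlang_surv_ge0.
- apply: measurable_funTS; apply/measurable_EFinP; apply: measurable_funM;
    last exact: measurableT_comp.
  by apply: measurableT_comp (measurable_erlang_surv k) _; exact: measurable_funB.
Qed.

Lemma prob_RV_gt i r : 0 <= r -> P (h i @^-1` `]r, +oo[%classic) = (expR (- r))%:E.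
Proof.
move=> r0; rewrite exp1_preimage// -integral_expRN_oy; apply: eq_integral => y.
rewrite inE/= in_itv/= andbT => ry.
by rewrite /pdf exponential_pdfE ?mul1r ?mulN1r// (le_trans r0 (ltW ry)).
Qed.

Lemma prob_RV_le i r : 0 <= r -> P (h i @^-1` `]-oo, r]%classic) = (1 - expR (- r))%:E.
Proof.
move=> r0; rewrite EFinB -(prob_RV_gt i r0) -probability_setC;
  last exact: measurable_RV_preimage.
by congr (P _); rewrite preimage_setC setCitvr.
Qed.

Lemma prob_exceed S B : (forall i, measurable (B i)) ->
  P (exceed S B) =
  ((expR (- tau) ^+ #|S|)%:E * \prod_(i | i \notin S) P (h i @^-1` B i))%E.
Proof.
move=> mB; rewrite [LHS]h_indep; last by move=> i; case: ifP.
rewrite (bigID (mem S))/=; congr (_ * _)%E.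
  rewrite (eq_bigr (fun=> (expR (- tau))%:E)).
    by rewrite prodEFin prodr_const.
  by move=> i iS; rewrite iS prob_RV_gt.
by apply: eq_bigr => i /negbTE ->.
Qed.

(** User [i] will be the grant-based one, whose gain sets the level the sum must exceed. The offset
    [#|S|%:R * tau] cancels the shift in [exceed_surv] and leaves the tail at [a * (y - s)]. *)
Lemma prob_exceed_sum S i B r a s : i \notin S -> 0 <= r ->
  (forall i, measurable (B i)) ->
  P (exceed S (override B i `]r, +oo[%classic) `&`
     [set w | a * (h i w - s) + #|S|%:R * tau < gain_sum S w]) =
  ((\prod_(j | (j \notin S) && (j != i)) P (h j @^-1` B j)) *
   ((expR (- tau) ^+ #|S|)%:E *
    \int[lebesgue_measure]_(y in `]r, +oo[)
      (erlang_surv #|S| (a * (y - s)) * expR (- y))%:E))%E.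
Proof.
move=> iS r0 mB.
pose E : set (R * R) := [set z | r < z.2 /\ a * (z.2 - s) + #|S|%:R * tau < z.1].
have mE : measurable E.
  rewrite [E](_ : _ = snd @^-1` `]r, +oo[%classic `&`
      (fun z : R * R => z.1 - (a * (z.2 - s) + #|S|%:R * tau)) @^-1` `]0, +oo[%classic).
    apply: measurableI.
    - by rewrite -[X in measurable X]setTI; exact: measurable_snd.
    - rewrite -[X in measurable X]setTI.
      apply: measurable_funB => //.
      apply: measurable_funD => //; apply: measurable_funM => //.
      by apply: measurable_funB => //; exact: measurable_snd.
  by apply/seteqP; split => z /=; rewrite !in_itv/= !andbT subr_gt0.
rewrite exceedD// -setIA.
rewrite (_ : h i @^-1` _ `&` _ = (fun w => (gain_sum S w, h i w)) @^-1` E); last first.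
  by apply/seteqP; split => w /=; rewrite in_itv/= andbT.
rewrite exceed_pair//; last exact: exceed_factorT.
congr (_ * _)%E; rewrite -ge0_integralZl_EFin//=; last 2 first.
- by move=> y _; rewrite lee_fin mulr_ge0 ?expR_ge0// erlang_surv_ge0.
- apply: measurable_funTS; apply/measurable_EFinP; apply: measurable_funM;
    last exact: measurableT_comp.
  apply: measurableT_comp (measurable_erlang_surv _) _.
  by apply: measurable_funM => //; exact: measurable_funB.
rewrite [in RHS]integral_mkcond; apply: eq_integral => y _; rewrite patchE.
rewrite mem_setE in_itv/= andbT; case: ifPn => ry.
  rewrite [_ @^-1` _](_ : _ =
    gain_sum S @^-1` `](a * (y - s) + #|S|%:R * tau), +oo[%classic); last first.
    apply/seteqP; split => w /=; rewrite in_itv/= andbT.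
      by move=> /ysectionP[].
    by move=> sw; apply/ysectionP.
  rewrite exceed_surv addrK /pdf exponential_pdfE ?(le_trans r0 (ltW ry))// mul1r mulN1r.
  by rewrite -!EFinM mulrA -mulrN expRM_natl.
rewrite [_ @^-1` _](_ : _ = set0) ?setI0 ?measure0 ?mul0e//.
apply/seteqP; split => // w /= /ysectionP[/=].
by rewrite (negbTE ry).
Qed.

End erlang_sum.

(** * Top order statistics as the entries above the threshold *)

Lemma sum_sort_top (R : realDomainType) (tau : R) (s : seq R) :
  \sum_(size s - count (> tau) s + 1 <= j < (size s).+1) nth 0 (sort <=%R s) j.-1 =
  \sum_(x <- s | tau < x) x.
Proof.
set t := sort <=%R s.
have st : sorted <=%R t by exact: sort_le_sorted.
have szt : size t = size s by rewrite size_sort.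
have ct p : count p t = count p s by apply/permP; rewrite perm_sort.
(* In the sorted list the entries above [tau] start at the index that counts the entries at most
   [tau], so the top slice is exactly the filtered list. *)
have cle : (size s - count (> tau) s)%N = count (<= tau) t.
  rewrite -(count_predC (> tau) s) addKn ct; apply: eq_count => x /=.
  by rewrite leNgt.
rewrite cle addn1 big_add1/=.
rewrite [RHS](perm_big t)/=; last by rewrite perm_sym perm_sort.
rewrite -[RHS]big_filter (sorted_filter_gt tau st) [RHS](big_nth 0) size_drop szt.
rewrite -{1}[count _ t]add0n big_addn.
by apply: eq_bigr => i _; rewrite nth_drop addnC.
Qed.

Section admitted.
Context (R : realType) d (T : measurableType d) (P : probability T R) (M : nat).
Variables (h : 'I_M.+1 -> {RV P >-> R}) (tau : R).
Implicit Types (S : {set 'I_M.+1}) (w : T).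

Definition admitted w : {set 'I_M.+1} :=
  [set i : 'I_M.+1 | (0 < i)%N && (tau < h i w)]%SET.

(** The admitted set is [S] and [h ord0] lies in [A]. *)
Definition admitted_event S (A : set R) : set T :=
  exceed h tau S (override (fun=> `]-oo, tau]%classic) ord0 A).

Lemma num_admittedE w : num_admitted h tau w = #|admitted w|.
Proof.
by apply: eq_card => i; rewrite finset.inE; apply/idP/idP; rewrite inE.
Qed.

Lemma admitted_eventP S w : ord0 \notin S ->
  admitted_event S setT w <-> admitted w = S.
Proof.
move=> S0; split=> [hw|wS i _].
  apply/finset.setP => i; rewrite finset.inE; have := hw i Logic.I.
  rewrite /= /override; case: ifPn => iS.
    rewrite /= in_itv/= andbT => ->; rewrite andbT lt0n.
    by apply: contraNneq S0 => i0; rewrite (_ : ord0 = i)//; exact: val_inj.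
  case: eqP => [->//|_] /=; rewrite in_itv/= leNgt => /negbTE ->.
  by rewrite andbF.
have : i \in admitted w = (i \in S) by rewrite wS.
rewrite /= finset.inE /override; case: ifPn => iS.
  by move=> /andP[_ ti]; rewrite /= in_itv/= ti.
case: eqVneq => // i0 /negbT; rewrite negb_and -leNgt /= in_itv/=.
by case: posnP => // ii; case/eqP: i0; exact: val_inj.
Qed.

Lemma admitted_gains (V : nmodType) (G : R -> V) w :
  \sum_(i in admitted w) G (h i w) =
  \sum_(x <- [seq h (lift ord0 m) w | m : 'I_M] | tau < x) G x.
Proof.
rewrite big_image_cond/= big_mkcond big_ord_recl/= [X in X + _]ifF ?finset.inE//.
rewrite add0r -big_mkcond/=; apply: eq_bigl => m.
by rewrite finset.inE.
Qed.

Lemma top_sum_admitted w : top_sum h #|admitted w| w = \sum_(i in admitted w) h i w.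
Proof.
rewrite (admitted_gains id) -sum_sort_top /top_sum /order_stats.
set s := [seq _ | _ in _].
have sM : size s = M by rewrite size_image card_ord.
rewrite sM; congr (\sum_(M - _ + 1 <= j < _) _).
by rewrite -sum1_card (admitted_gains (fun=> 1%N)) sum1_count.
Qed.

Lemma prob_num_admitted n (G : set T) (p : R) :
  (forall S, ord0 \notin S -> #|S| = n ->
    measurable (admitted_event S setT `&` G)) ->
  (forall S, ord0 \notin S -> #|S| = n ->
    P (admitted_event S setT `&` G) = p%:E) ->
  P ([set w | num_admitted h tau w = n] `&` G) = ('C(M, n)%:R * p)%:E.
Proof.
move=> mS pS.
pose D := enum [set S : {set 'I_M.+1} | (S \subset [set~ ord0]) && (#|S| == n)]%SET.
have inD S : reflect (ord0 \notin S /\ #|S| = n) (S \in D).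
  rewrite mem_enum finset.inE finset.subsetC finset.sub1set finset.in_setC.
  by apply: (iffP andP) => -[-> /eqP]; split => //; apply/eqP.
rewrite (_ : _ `&` G = \bigcup_(S in [set` D]) (admitted_event S setT `&` G)).
  rewrite measure_fin_bigcup//=.
  - rewrite -fsbig_seq ?enum_uniq//= (eq_big_seq (fun=> p%:E)).
      rewrite sumEFin; congr EFin.
      rewrite big_const_seq count_predT -cardE cards_draws finset.cardsC1 card_ord/=.
      by rewrite iter_addr addr0 mulr_natl.
    by move=> S /inD[S0 Sn]; exact: pS.
  - move=> S S' /inD[S0 _] /inD[S0' _] [w [[wS _] [wS' _]]].
    by rewrite -((admitted_eventP w S0).1 wS) ((admitted_eventP w S0').1 wS').
  - by move=> S /inD[S0 Sn]; exact: mS.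
apply/seteqP; split => w /=.
  move=> [wn Gw]; exists (admitted w) => /=.
    apply/inD; split; first by rewrite finset.inE.
    by rewrite -num_admittedE.
  by split => //; apply/admitted_eventP => //; rewrite finset.inE.
move=> [S /= /inD[S0 Sn] [wS Gw]]; split => //.
by rewrite num_admittedE ((admitted_eventP w S0).1 wS).
Qed.

Hypotheses (tau_ge0 : 0 <= tau) (h_indep : mutually_independent h).
Hypothesis h_exp : forall i, exp1_distributed (h i).

Lemma prod_rejected S : ord0 \notin S ->
  (\prod_(j | (j \notin S) && (j != ord0)) P (h j @^-1` `]-oo, tau]%classic) =
   ((1 - expR (- tau)) ^+ (M - #|S|))%:E)%E.
Proof.
move=> S0; rewrite (eq_bigr (fun=> (1 - expR (- tau))%:E)); last first.
  by move=> j _; exact: prob_RV_le.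
rewrite prodEFin prodr_const; congr (_ ^+ _)%:E.
transitivity #|(~: (ord0 |: S))%SET|.
  by apply: eq_card => j; rewrite !inE negb_or andbC.
apply/eqP; rewrite -(eqn_add2l #|ord0 |: S|%SET) finset.cardsC card_ord finset.cardsU1 S0.
rewrite add1n addSn subnKC//.
have := max_card (mem (ord0 |: S)%SET).
by rewrite finset.cardsU1 S0 card_ord add1n ltnS.
Qed.

Lemma measurable_admitted_event S A : measurable A -> measurable (admitted_event S A).
Proof. by move=> mA; apply: measurable_exceed; exact: measurable_override. Qed.

Lemma prob_admitted_event S : ord0 \notin S ->
  P (admitted_event S setT) =
  (expR (- tau) ^+ #|S| * (1 - expR (- tau)) ^+ (M - #|S|))%:E.
Proof.
move=> S0; rewrite prob_exceed//; last exact: measurable_override.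
rewrite EFinM -prod_rejected//; congr (_ * _)%E.
rewrite (bigD1 ord0)//= /override eqxx preimage_setT probability_setT mul1e.
by apply: eq_bigr => j /andP[_ /negbTE ->].
Qed.

Lemma prob_num_admittedE n :
  P [set w | num_admitted h tau w = n] =
  ('C(M, n)%:R * (expR (- tau) ^+ n * (1 - expR (- tau)) ^+ (M - n)))%:E.
Proof.
rewrite -[X in P X]setIT.
apply: prob_num_admitted => S S0 Sn; rewrite setIT.
  exact: measurable_admitted_event.
by rewrite prob_admitted_event// Sn.
Qed.

Lemma prob_num_admitted_decoded n (r a s : R) : 0 <= r -> 0 < a ->
  let t := Num.max s r in let c := 1 + a in
  P ([set w | num_admitted h tau w = n.+1] `&`
     [set w | r < h ord0 w /\ a * (h ord0 w - s) + n.+1%:R * tau < top_sum h n.+1 w]) =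
  ('C(M, n.+1)%:R * ((1 - expR (- tau)) ^+ (M - n.+1) * (expR (- tau) ^+ n.+1 *
    (expR (- r) - expR (- t) +
     \sum_(l < n.+1) a ^+ l / l`!%:R * expR (- s) *
       upper_inc_gamma l.+1%:R ((t - s) * c) / c ^+ l.+1))))%:E.
Proof.
move=> r0 a0 t c.
have decodedE S : ord0 \notin S -> #|S| = n.+1 ->
    admitted_event S setT `&`
      [set w | r < h ord0 w /\ a * (h ord0 w - s) + n.+1%:R * tau < top_sum h n.+1 w] =
    admitted_event S `]r, +oo[%classic `&`
      [set w | a * (h ord0 w - s) + #|S|%:R * tau < gain_sum h S w].
  move=> S0 Sn; rewrite /admitted_event [in RHS]exceedD//.
  have topE w : admitted_event S setT w -> top_sum h n.+1 w = gain_sum h S w.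
    move=> /(admitted_eventP w S0) wS.
    by rewrite -Sn -wS top_sum_admitted /gain_sum mfun_sum.
  apply/seteqP; split=> w /=; rewrite Sn in_itv/= andbT.
    by move=> [wS [rh]]; rewrite topE.
  by move=> [[wS rh] ?]; split => //; split => //; rewrite topE.
apply: prob_num_admitted => S S0 Sn; rewrite decodedE//.
  apply: measurableI; first exact: measurable_admitted_event.
  rewrite [X in measurable X](_ : _ =
      (fun w => gain_sum h S w - (a * (h ord0 w - s) + #|S|%:R * tau)) @^-1`
      `]0, +oo[%classic).
    rewrite -[X in measurable X]setTI; apply: measurable_funB => //.
    by apply: measurable_funD => //; apply: measurable_funM => //; exact: measurable_funB.
  by apply/seteqP; split => w /=; rewrite in_itv/= andbT subr_gt0.
rewrite prob_exceed_sum// prod_rejected// Sn integral_erlang_surv_affine//.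
Qed.

End admitted.

(** * From rate conditions to gain thresholds, and the closed form of the outage probability *)

Lemma log2_gt (R : realType) (q x : R) : 0 < q -> (q < log2 x) = (2 `^ q < x).
Proof.
move=> q0; have ln2 : 0 < ln (2 : R) by rewrite ln_gt0// ltr1n.
rewrite /log2 ltr_pdivlMr//; have [x0|x0] := ltP 0 x.
  by rewrite /powR pnatr_eq0/= -[in RHS](lnK x0) ltr_expR.
(* For [x <= 0] the default value [ln x = 0] makes the left side false as [q > 0], and the right
   side is false because powers of 2 are nonnegative. *)
by rewrite (ln0 x0) !le_gtF ?(le_trans x0) ?powR_ge0// mulr_ge0// ltW.
Qed.

Theorem theorem2 (R : realType) (d : measure_display) (T : measurableType d)
  (P : probability T R) (M : nat) (h : 'I_M.+1 -> {RV P >-> R})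
  (tau P0 Pbar R0 Ri : R) :
  (1 <= M)%N ->
  0 < tau -> 0 < P0 -> 0 < Pbar -> 0 < R0 -> 0 < Ri ->
  mutually_independent h ->
  (forall i, exp1_distributed (h i)) ->
  let h0 := h ord0 in
  let N := num_admitted h tau in
  let eps0 := 2 `^ R0 - 1 in
  let eps_s := fun n : nat => 2 `^ (n%:R * Ri) - 1 in
  let E0 := [set w | log2 (1 + h0 w * P0) > R0] in
  let Q3 := fun n : nat =>
    cond_prob P
      [set w | log2 (1 + h0 w * P0) > R0 /\
               log2 (1 + Pbar * top_sum h n w / (1 + h0 w * P0)) > n%:R * Ri]
      [set w | N w = n] in
  let P0_OL := 1 - \sum_(1 <= n < M.+1) prob P [set w | N w = n] * Q3 n
                 - prob P [set w | N w = 0%N] * prob P E0 in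
  let tau_n := fun n : nat => (n%:R * tau * (eps_s n)^-1 * Pbar - 1) / P0 in
  let taub_n := fun n : nat => Num.max (tau_n n) (eps0 / P0) in
  let c := fun n : nat => 1 + eps_s n * Pbar^-1 * P0 in
  P0_OL =
    1 - \sum_(1 <= n < M.+1)
          ('C(M, n)%:R * expR (- (n%:R * tau)) * (1 - expR (- tau)) ^+ (M - n) *
           (\sum_(1 <= l < n)
              ((eps_s n) ^+ l * (Pbar^-1) ^+ l * P0 ^+ l / (l`!)%:R *
               expR (- tau_n n) *
               upper_inc_gamma (l.+1%:R) ((taub_n n - tau_n n) * c n) /
               (c n) ^+ l.+1)
            + expR (- (eps0 / P0)) - expR (- taub_n n)
            + expR (- tau_n n - (taub_n n - tau_n n) * c n) / c n))
      - (1 - expR (- tau)) ^+ M * expR (- (eps0 / P0)).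
Proof.
move=> M1 tau0 P0_gt0 Pbar0 R00 Ri0 h_indep h_exp.
move=> h0 N eps0 eps_s E0 Q3 P0_OL tau_n taub_n c.
have pow2_gt1 (q : R) : 0 < q -> 1 < 2 `^ q.
  by move=> q0; rewrite /powR pnatr_eq0/= expR_gt1 mulr_gt0// ln_gt0// ltr1n.
have tau_ge0 := ltW tau0.
have r_ge0 : 0 <= eps0 / P0 by rewrite divr_ge0 ?ltW// subr_gt0 pow2_gt1.
have E0E : E0 = h0 @^-1` `](eps0 / P0), +oo[%classic.
  apply/seteqP; split => w; rewrite /E0 /= in_itv/= andbT log2_gt//.
    by rewrite ltr_pdivrMr// ltrBlDl.
  by rewrite ltr_pdivrMr// ltrBlDl.
rewrite /P0_OL; congr (1 - _ - _).
  apply: eq_big_nat => -[//|n] /andP[_ nM].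
  have epsn : 0 < eps_s n.+1 by rewrite subr_gt0 pow2_gt1// mulr_gt0// ltr0n.
  set a := eps_s n.+1 * Pbar^-1 * P0.
  have a0 : 0 < a by rewrite !mulr_gt0 ?invr_gt0.
  (* A nonzero denominator lets the weight of [Q3] cancel the one in [cond_prob], leaving a joint
     probability. It uses [n.+1 <= M] for the binomial and [0 < tau] for the rejection factor. *)
  have pN : prob P [set w | N w = n.+1] != 0.
    rewrite /prob prob_num_admittedE//= !mulf_neq0 ?expf_neq0//.
    - by rewrite pnatr_eq0 -lt0n bin_gt0.
    - by rewrite gt_eqF ?expR_gt0.
    - by rewrite subr_eq0 eq_sym lt_eqF// expR_lt1 oppr_lt0.
  rewrite /Q3 /cond_prob mulrC divfK// setIC.
  rewrite (_ : [set w | _ /\ _] = [set w | eps0 / P0 < h0 w /\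
      a * (h0 w - tau_n n.+1) + n.+1%:R * tau < top_sum h n.+1 w]); last first.
    apply/seteqP; suff decE w : (R0 < log2 (1 + h0 w * P0) /\
        n.+1%:R * Ri < log2 (1 + Pbar * top_sum h n.+1 w / (1 + h0 w * P0))) <->
        (eps0 / P0 < h0 w /\ a * (h0 w - tau_n n.+1) + n.+1%:R * tau < top_sum h n.+1 w).
      by split => w /decE.
    rewrite !log2_gt ?mulr_gt0 ?ltr0n// ltr_pdivrMr// -!ltrBlDl -/eps0 -/(eps_s n.+1).
    (* The rate condition of the grant-based user makes [1 + h0 w * P0] positive, so the denominator
       of the second condition can be cleared. *)
    suff decE : eps0 < h0 w * P0 ->
        (eps_s n.+1 < Pbar * top_sum h n.+1 w / (1 + h0 w * P0)) =
        (a * (h0 w - tau_n n.+1) + n.+1%:R * tau < top_sum h n.+1 w).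
      by split=> -[h0w]; rewrite decE.
    move=> h0w.
    have D0 : 0 < 1 + h0 w * P0.
      by rewrite addr_gt0// (lt_trans _ h0w)// subr_gt0 pow2_gt1.
    (* [tau_n] is the value of [h0 w] at which the required sum [eps_s * (1 + h0 w * P0) / Pbar]
       equals its minimum [n * tau] under admission; [a] is the slope of this affine function. *)
    rewrite ltr_pdivlMr// -ltr_pdivrMl//; congr (_ < _).
    by rewrite /a /tau_n; field; rewrite !gt_eqF.
  rewrite /prob prob_num_admitted_decoded//= -/(taub_n n.+1) -/(c n.+1).
  have t_ge : 0 <= (taub_n n.+1 - tau_n n.+1) * c n.+1.
    by rewrite mulr_ge0 ?subr_ge0 ?le_max ?lexx// addr_ge0// ltW.
  rewrite -(mulrN n.+1%:R tau) expRM_natl.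
  rewrite -(big_mkord xpredT (fun l => a ^+ l / l`!%:R * expR (- tau_n n.+1) *
    upper_inc_gamma l.+1%:R ((taub_n n.+1 - tau_n n.+1) * c n.+1) / c n.+1 ^+ l.+1)).
  (* The term [l = 0] is split off: there the incomplete Gamma function is an exponential, which
     gives the last summand of the formula. *)
  rewrite big_ltn// upper_inc_gamma1// expr0 divr1 mul1r -expRD expr1.
  under [X in _ * (_ * (_ * (_ + (_ + X))))]eq_bigr do rewrite !exprMn.
  by ring.
have := prob_num_admittedE tau_ge0 h_indep h_exp 0.
rewrite /prob E0E prob_RV_gt//= => ->/=.
by rewrite bin0 mul1r expr0 mul1r subn0.
Qed.
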